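(* Let $A,B\in\mathbb{C}^{N\times N}$ be commuting matrices such that $A+sI$ and $B+sI$ are invertible for every integer $s\ge0$. Then for every integer $n\ge0$ the Bateman matrix polynomial $\mathbf{B}_n^{A,B}(z)$ satisfies the third order differential equation $$z^2\frac{d^3}{dz^3}\mathbf{B}_n^{A,B}(z)+(A+B+3I)z\frac{d^2}{dz^2}\mathbf{B}_n^{A,B}(z)+\left[(A+I)(B+I)-zI\right]\frac{d}{dz}\mathbf{B}_n^{A,B}(z)+n\mathbf{B}_n^{A,B}(z)=\mathbf{0}.$$
   Context: $I$ is the $N\times N$ identity matrix, $\mathbf 0$ the zero matrix; for $M\in\mathbb{C}^{N\times N}$, $(M)_0=I$ and $(M)_k=M(M+I)\cdots(M+(k-1)I)$ for $k\ge1$. The Bateman matrix polynomials are $$\mathbf{B}_n^{A,B}(z)=\sum_{k=0}^{n}\frac{(-1)^k n!\,z^k}{k!\,(n-k)!}[(A+I)_k]^{-1}[(B+I)_k]^{-1}.$$ *)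

(* Defs.v *)
From HB Require Import structures.
From mathcomp Require Import all_boot all_order all_algebra.
From mathcomp Require Import all_classical all_reals all_analysis.
From mathcomp Require Import complex.

Set Implicit Arguments.
Unset Strict Implicit.
Unset Printing Implicit Defensive.

Import GRing.Theory Num.Theory.
Import numFieldNormedType.Exports.

Local Open Scope ring_scope.

(* [R[i]] has no topology of its own in the library.  Packaging it as a
   [numClosedFieldType] gives it, and the matrices over it, the norm topology
   that [numFieldNormedType] attaches to every [numFieldType], which is what
   [derive1] (the limit of difference quotients) needs. *)
Definition Cplx (R : realType) : numClosedFieldType := R[i].

(* The product is the ring product of square matrices, taken in increasing
   order of [j]; the empty product is the identity matrix. *)
Definition mxpoch (R : realType) (N : nat) (M : 'M[Cplx R]_N) (k : nat)
    : 'M[Cplx R]_N :=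
  \prod_(j < k) (M + (j%:R)%:M).

Definition bateman (R : realType) (N : nat) (A B : 'M[Cplx R]_N) (n : nat)
    (z : Cplx R) : 'M[Cplx R]_N :=
  \sum_(k < n.+1)
    ((-1) ^+ k * n`!%:R * z ^+ k / (k`!%:R * (n - k)`!%:R)) *:
      (invmx (mxpoch (A + 1%:M) k) *m invmx (mxpoch (B + 1%:M) k)).

(* Main.v *)
Require Import Defs.
From mathcomp Require Import all_boot all_order all_algebra.
From mathcomp Require Import all_classical all_reals all_analysis.
From mathcomp Require Import complex.
From mathcomp Require Import ring.
Import numFieldNormedType.Exports.
Local Open Scope ring_scope.
Import GRing.Theory Num.Theory.

(** The Bateman polynomial is a polynomial in [z] with matrix coefficients
    [c_k = (-1)^k 'C(n, k) [(A+I)_k]^-1 [(B+I)_k]^-1], and the differential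
    equation is solved by comparing coefficients of [z^k].

    Differentiation sends the coefficient sequence [c] to
    [k |-> (k+1) c_(k+1)] ([derive1_vpoly]), and [z d/dz] multiplies [c_k] by
    [k] ([vpoly_dcoef_id]).  Writing every term of the equation through [z d/dz]
    and [c' = dcoef c], the coefficient of [z^k] on the left-hand side is
    [(k (k-1) + k (A+B+3I) + (A+I)(B+I)) c'_k - k c_k + n c_k],
    so the equation reduces to a two-term recurrence ([vpoly_ode]).

    The matrix factor is [(A+(k+1)I)(B+(k+1)I)] ([mx_indicial_factor]).  Since
    [A] and [B] commute, it cancels exactly the last factor of each of the two
    Pochhammer inverses in [c_(k+1)] ([mul_invmx_mxpochS2]), and
    [(k+1) 'C(n, k+1) = (n-k) 'C(n, k)] accounts for the scalars
    ([bateman_coef_rec]). *)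

(** * Polynomials with vector coefficients *)

Section VectorPolynomials.
Context {K : numFieldType} {V : normedModType K}.

(** The coefficients are a sequence on all of [nat], so that derivatives and
    [z d/dz] act on the sequence alone and leave the number [m] of summands
    unchanged, as soon as the sequence vanishes from [m] on. *)
Definition vpoly (m : nat) (c : nat -> V) (z : K) : V :=
  \sum_(k < m) z ^+ k *: c k.

Definition dcoef (c : nat -> V) (k : nat) : V := k.+1%:R *: c k.+1.

Lemma vpolyD m (c d : nat -> V) (z : K) :
  vpoly m c z + vpoly m d z = vpoly m (fun k => c k + d k) z.
Proof. by rewrite -big_split; apply: eq_bigr => k _; rewrite scalerDr. Qed.

Lemma vpolyN m (c : nat -> V) (z : K) :
  vpoly m (fun k => - c k) z = - vpoly m c z.
Proof. by rewrite -sumrN; apply: eq_bigr => k _; rewrite scalerN. Qed.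

Lemma vpolyZ m (c : nat -> V) (a z : K) :
  a *: vpoly m c z = vpoly m (fun k => a *: c k) z.
Proof.
by rewrite scaler_sumr; apply: eq_bigr => k _; rewrite !scalerA mulrC.
Qed.

(** Coefficientwise form of the Euler operator [z d/dz]: multiplying by [z]
    undoes the index shift of [dcoef]. *)
Lemma vpoly_dcoef_id m (c : nat -> V) (z : K) : c m = 0 ->
  z *: vpoly m (dcoef c) z = vpoly m (fun k => k%:R *: c k) z.
Proof.
case: m => [|m] cm; first by rewrite /vpoly !big_ord0 scaler0.
rewrite /vpoly big_ord_recr [RHS]big_ord_recl /dcoef /= cm !scaler0 addr0.
rewrite scale0r scaler0 add0r scaler_sumr; apply: eq_bigr => k _.
by rewrite scalerA -exprS.
Qed.

Lemma is_derive_scale_exp k (v : V) (z : K) :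
  is_derive z 1 (fun y : K => y ^+ k *: v) (k%:R * z ^+ k.-1 *: v).
Proof.
have dX : differentiable (fun y : K => y ^+ k) z.
  exact/derivable1_diffP/exprn_derivable.
have dXv : differentiable (fun y : K => y ^+ k *: v) z.
  exact: differentiableZl.
apply: DeriveDef; first exact: diff_derivable.
rewrite deriveE// diffZl// -deriveE// exp_derive.
by rewrite /GRing.scale /= mulr1.
Qed.

Lemma derive1_vpoly m (c : nat -> V) : c m = 0 ->
  derive1 (vpoly m c) = vpoly m (dcoef c).
Proof.
move=> cm; apply/funext => z; rewrite derive1E.
have -> : vpoly m c = \sum_(k < m) (fun y : K => y ^+ k *: c k).
  by apply/funext => y; rewrite fct_sumE.
have dsum := is_derive_sum (fun k : 'I_m => is_derive_scale_exp k (c k) z).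
rewrite (@derive_val _ _ _ _ _ _ _ dsum).
case: m cm {dsum} => [|m] cm; first by rewrite /vpoly !big_ord0.
rewrite /vpoly big_ord_recl [RHS]big_ord_recr /dcoef /= cm !scaler0 addr0.
rewrite mul0r scale0r add0r; apply: eq_bigr => k _.
by rewrite scalerA mulrC.
Qed.

End VectorPolynomials.

(** * From a two-term recurrence to the differential equation *)

Lemma mul_mx_vpoly (K : numFieldType) (N m : nat) (X : 'M[K]_N)
    (c : nat -> 'M[K]_N) (z : K) :
  X *m vpoly m c z = vpoly m (fun k => X *m c k) z.
Proof.
by rewrite mulmx_sumr; apply: eq_bigr => k _; rewrite -scalemxAr.
Qed.

(** Method of power series: with [c' = dcoef c], the coefficients of [z^k] in
    [z^2 D^3 f], [z D^2 f], [D f] and [z D f] are [k (k-1) c'_k], [k c'_k], [c'_k]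
    and [k c_k], so the recurrence says that every coefficient of the left-hand
    side is zero. *)
Lemma vpoly_ode (K : numFieldType) (N n : nat) (S T : 'M[K]_N)
    (c : nat -> 'M[K]_N) (z : K) :
  (forall k, (n < k)%N -> c k = 0) ->
  (forall k, (k <= n)%N ->
    ((k%:R * (k%:R - 1))%:M + k%:R *: S + T) *m dcoef c k
      = (k%:R - n%:R) *: c k) ->
  z ^+ 2 *: derive1n 3 (vpoly n.+1 c) z
  + (z *: S) *m derive1n 2 (vpoly n.+1 c) z
  + (T - z%:M) *m derive1 (vpoly n.+1 c) z
  + n%:R *: vpoly n.+1 c z = 0.
Proof.
move=> c0 rec.
have d0 k : (n < k)%N -> dcoef c k = 0.
  by move=> nk; rewrite /dcoef c0 ?scaler0 // ltnW.
have e0 k : (n < k)%N -> dcoef (dcoef c) k = 0.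
  by move=> nk; rewrite /dcoef -/(dcoef c _) d0 ?scaler0 // ltnW.
have z2d3 : z ^+ 2 *: vpoly n.+1 (dcoef (dcoef (dcoef c))) z
    = vpoly n.+1 (fun k => (k%:R * (k%:R - 1)) *: dcoef c k) z.
  rewrite expr2 -scalerA vpoly_dcoef_id; last exact: e0.
  (* One factor [z] is spent; the weight [k] it leaves is, after the index
     shift of [dcoef], a weight [k - 1], so that the result is again a
     [dcoef] and can absorb the second factor. *)
  have -> : (fun k => k%:R *: dcoef (dcoef c) k)
      = dcoef (fun k => (k%:R - 1) *: dcoef c k).
    apply/funext => k; rewrite /dcoef !scalerA; congr (_ *: _).
    by rewrite -[in RHS]natr1; ring.
  rewrite vpoly_dcoef_id; last by rewrite d0 ?scaler0.
  by congr vpoly; apply/funext => k; rewrite scalerA.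
rewrite /derive1n /=.
rewrite (derive1_vpoly n.+1 _ (c0 _ (ltnSn n))).
rewrite (derive1_vpoly n.+1 _ (d0 _ (ltnSn n))).
rewrite (derive1_vpoly n.+1 _ (e0 _ (ltnSn n))).
rewrite z2d3 -scalemxAl scalemxAr vpoly_dcoef_id; last exact: d0.
rewrite mulmxBl mul_scalar_mx vpoly_dcoef_id; last exact: c0.
rewrite -vpolyN !mul_mx_vpoly !vpolyZ !vpolyD /vpoly big1 // => k _.
have kn : (k <= n)%N by rewrite -ltnS.
rewrite -[RHS](scaler0 _ (z ^+ k)); congr (_ *: _).
have := rec k kn.
rewrite !mulmxDl mul_scalar_mx -scalemxAl (scalemxAr _ S) => /eqP.
rewrite scalerBl -subr_eq0 opprB => /eqP <-.
rewrite !addrA; exact: addrAC.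
Qed.

(** Expand the right-hand side in powers of [k]; the scalar matrix [k] commutes
    with everything, so the order of [A] and [B] is preserved. *)
Lemma mx_indicial_factor (K : numFieldType) (N : nat) (A B : 'M[K]_N)
    (k : nat) :
  (k%:R * (k%:R - 1))%:M + k%:R *: (A + B + 3%:M) + (A + 1%:M) *m (B + 1%:M)
  = (A + 1%:M + (k%:R)%:M) *m (B + 1%:M + (k%:R)%:M).
Proof.
rewrite [RHS]mulmxDl [in RHS]mulmxDr [in RHS]mul_mx_scalar.
rewrite [in RHS]mul_scalar_mx addrC -[RHS]addrA; congr (_ + _).
rewrite -[(_ * _)%:M]scale_scalar_mx -scalerDr -scalerDr; congr (_ *: _).
by apply/matrixP => i j; rewrite !mxE; ring.
Qed.

(** * Inverses of Pochhammer matrices *)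

Lemma comm_mx_invmx (K : comUnitRingType) (N : nat) (X Y : 'M[K]_N) :
  Y \in unitmx -> comm_mx X Y -> comm_mx X (invmx Y).
Proof.
move=> uY XY; rewrite /comm_mx -[X *m _]mul1mx -(mulVmx uY) -!mulmxA.
by rewrite [Y *m (X *m _)]mulmxA -XY -mulmxA mulmxV // mulmx1.
Qed.

Section Pochhammer.
Context {R : realType} {N : nat}.
Implicit Types M X A B : 'M[Cplx R]_N.

Lemma mxpochS M k : mxpoch M k.+1 = mxpoch M k *m (M + (k%:R)%:M).
Proof. by rewrite /mxpoch big_ord_recr. Qed.

Lemma mxpoch_unit M k : (forall s : nat, M + (s%:R)%:M \in unitmx) ->
  mxpoch M k \in unitmx.
Proof.
move=> hM; elim: k => [|k IH]; first by rewrite /mxpoch big_ord0 unitmx1.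
by rewrite mxpochS unitmx_mul IH hM.
Qed.

Lemma comm_mx_mxpoch X M k : comm_mx X M -> comm_mx X (mxpoch M k).
Proof.
move=> XM; elim: k => [|k IH].
  by rewrite /mxpoch big_ord0; exact: comm_mx1.
rewrite mxpochS; apply: comm_mxM => //.
by apply: comm_mxD => //; exact: comm_mx_scalar.
Qed.

(** Inversion reverses the order of the factors, so the last factor of the
    Pochhammer product stands leftmost in its inverse, where it is cancelled. *)
Lemma mul_invmx_mxpochS M k : (forall s : nat, M + (s%:R)%:M \in unitmx) ->
  (M + (k%:R)%:M) *m invmx (mxpoch M k.+1) = invmx (mxpoch M k).
Proof.
move=> hM.
have uk := mxpoch_unit M k hM; have uSk := mxpoch_unit M k.+1 hM.
rewrite -[LHS]mul1mx -(mulVmx uk) -!mulmxA [mxpoch M k *m _]mulmxA -mxpochS.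
by rewrite mulmxV // mulmx1.
Qed.

(** Commutativity of [A] and [B] is what lets the factor in [B] pass the
    inverse Pochhammer matrix of [A] and reach its own. *)
Lemma mul_invmx_mxpochS2 A B k : comm_mx A B ->
  (forall s : nat, A + (s%:R)%:M \in unitmx) ->
  (forall s : nat, B + (s%:R)%:M \in unitmx) ->
  (A + (k%:R)%:M) *m (B + (k%:R)%:M)
    *m (invmx (mxpoch A k.+1) *m invmx (mxpoch B k.+1))
  = invmx (mxpoch A k) *m invmx (mxpoch B k).
Proof.
move=> AB hA hB.
have BA : comm_mx (B + (k%:R)%:M) (invmx (mxpoch A k.+1)).
  apply: comm_mx_invmx; first exact: mxpoch_unit.
  apply: comm_mx_mxpoch; apply: comm_mx_sym; apply: comm_mxD => //.
  exact: comm_mx_scalar.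
rewrite -mulmxA [_ *m (invmx _ *m _)]mulmxA BA -mulmxA mul_invmx_mxpochS //.
by rewrite mulmxA mul_invmx_mxpochS.
Qed.

(** * Coefficients of the Bateman polynomials *)

(** Written with a binomial coefficient rather than the quotient of factorials
    of [bateman], because ['C(n, k)] vanishes for [k > n], whereas the
    truncated [(n - k)!] would leave a nonzero coefficient there. *)
Definition bateman_coef A B (n k : nat) : 'M[Cplx R]_N :=
  ((-1) ^+ k * 'C(n, k)%:R) *:
    (invmx (mxpoch (A + 1%:M) k) *m invmx (mxpoch (B + 1%:M) k)).

Lemma bateman_vpoly A B n : bateman A B n = vpoly n.+1 (bateman_coef A B n).
Proof.
apply/funext => z; apply: eq_bigr => k _; rewrite scalerA; congr (_ *: _).
have kn : (k <= n)%N by rewrite -ltnS.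
have h : k`!%:R * (n - k)`!%:R != 0 :> Cplx R.
  by rewrite -natrM pnatr_eq0 -lt0n muln_gt0 !fact_gt0.
by rewrite -(bin_fact kn) !natrM; apply: (canLR (mulfK h)); ring.
Qed.

Lemma bateman_coef_big A B n k : (n < k)%N -> bateman_coef A B n k = 0.
Proof. by move=> nk; rewrite /bateman_coef bin_small// mulr0 scale0r. Qed.

(** The matrix factors cancel against the Pochhammer inverses, and the scalars
    match by [(k+1) 'C(n, k+1) = (n-k) 'C(n, k)], the sign [(-1)^(k+1)]
    turning [n - k] into [k - n]. *)
Lemma bateman_coef_rec A B n k : comm_mx A B ->
  (forall s : nat, A + (s%:R)%:M \in unitmx) ->
  (forall s : nat, B + (s%:R)%:M \in unitmx) ->
  (k <= n)%N ->
  (A + 1%:M + (k%:R)%:M) *m (B + 1%:M + (k%:R)%:M)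
    *m dcoef (bateman_coef A B n) k
  = (k%:R - n%:R) *: bateman_coef A B n k.
Proof.
move=> AB hA hB kn.
have shift M : (forall s : nat, M + (s%:R)%:M \in unitmx) ->
    forall s : nat, M + 1%:M + (s%:R)%:M \in unitmx.
  by move=> hM s; rewrite -addrA -raddfD /= nat1r hM.
have AB1 : comm_mx (A + 1%:M) (B + 1%:M).
  apply: comm_mxD; last exact: comm_mx1.
  by apply: comm_mx_sym; apply: comm_mxD => //; exact: comm_mx1.
rewrite /dcoef /bateman_coef scalerA -scalemxAr.
rewrite mul_invmx_mxpochS2; [|by []|exact: shift..].
rewrite scalerA; congr (_ *: _).
by rewrite mulrCA -natrM mul_bin_left natrM natrB // exprS; ring.
Qed.

End Pochhammer.

Theorem theorem4p6 (R : realType) (N : nat) (A B : 'M[Cplx R]_N)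
    (hN : (0 < N)%N)
    (hAB : A *m B = B *m A)
    (hA : forall s : nat, A + (s%:R)%:M \in unitmx)
    (hB : forall s : nat, B + (s%:R)%:M \in unitmx)
    (n : nat) (z : Cplx R) :
  z ^+ 2 *: derive1n 3 (bateman A B n) z
  + (z *: (A + B + 3%:M)) *m derive1n 2 (bateman A B n) z
  + ((A + 1%:M) *m (B + 1%:M) - z%:M) *m derive1 (bateman A B n) z
  + n%:R *: bateman A B n z = 0.
Proof.
rewrite bateman_vpoly; apply: vpoly_ode => k nk.
  exact: bateman_coef_big.
by rewrite mx_indicial_factor; exact: bateman_coef_rec.
Qed.
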